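(* For every finite group $G$, $b_2(G)\le\mu'(G)$.
   Context: Let $G$ be a finite group. A permutation representation of $G$ is a homomorphism from $G$ to the group of permutations of a set $\Omega$ (not necessarily faithful). A base for the representation is a finite sequence of points of $\Omega$ whose pointwise stabiliser in the permutation group induced by $G$ is the identity; equivalently, the pointwise stabiliser in $G$ of the sequence is the kernel of the representation. A base is minimal if no point of the sequence is fixed by the pointwise stabiliser of the other points in the sequence. The size of a base is the number of its terms. $b_2(G)$ is the maximum, over all permutation representations of $G$ (not necessarily faithful), of the maximum size of a minimal base. A subset of $G$ is independent if none of its elements lies in the subgroup generated by the other elements. $\mu(G)$ is the maximal size of an independent generating set of $G$, and $\mu'(G)=\max\{\mu(H):H\le G\}$; equivalently, $\mu'(G)$ is the maximum size of an independent subset of $G$. *)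

(* Defs.v *)
From mathcomp Require Import all_boot all_fingroup.
From mathcomp Require Import boolp.

Set Implicit Arguments.
Unset Strict Implicit.
Unset Printing Implicit Defensive.

Import GroupScope.

(* A permutation representation of G on an arbitrary (possibly empty or
   infinite) set Omega is a right action [to : action G Omega]; it need not be
   faithful.  The library's stabiliser notations require a finite Omega. *)
Section Bases.

Variables (gT : finGroupType) (G : {group gT}) (Omega : Type).
Variable to : action G Omega.

Definition rep_ker : {set gT} := [set g in G | `[< forall x, to x g = x >]].

Definition pt_stab n (s : n.-tuple Omega) (I : {set 'I_n}) : {set gT} :=
  [set g in G | `[< forall i, i \in I -> to (tnth s i) g = tnth s i >]].

Definition is_base n (s : n.-tuple Omega) : Prop := pt_stab s setT = rep_ker.

(* The other points are the other terms of the sequence: if a point is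
   repeated, the base is not minimal. *)
Definition is_minimal_base n (s : n.-tuple Omega) : Prop :=
  is_base s /\
  forall i : 'I_n,
    ~ {in pt_stab s [set~ i], forall g, to (tnth s i) g = tnth s i}.

Definition minimal_base_size (n : nat) : bool :=
  `[< exists s : n.-tuple Omega, is_minimal_base s >].

Lemma base_exists : exists n, `[< exists s : n.-tuple Omega, is_base s >].
Proof.
case: (pselect (inhabited Omega)) => [[x0]|Omega0]; last first.
  exists 0; apply/asboolP; exists [tuple].
  apply/setP=> g; rewrite !inE; congr (_ && _); apply/asboolP/asboolP => _.
    by move=> x; case: Omega0; exists.
  by case.
have mv (g : gT) : exists x, to x g = x -> forall y, to y g = y.
  case: (pselect (exists y, to y g <> y)) => [[y nfix]|nomv].
    by exists y => /nfix.
  by exists x0 => _ y; apply: contrapT => nfix; apply: nomv; exists y.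
have /choice[f fP] := mv.
exists #|gT|; apply/asboolP; exists [tuple f (enum_val i) | i < #|gT|].
apply/setP=> g; rewrite !inE; congr (_ && _); apply/asboolP/asboolP => fixg.
  apply: fP; have := fixg (enum_rank g) (in_setT _).
  by rewrite tnth_mktuple enum_rankK.
by move=> i _; apply: fixg.
Qed.

Lemma minimal_base_size_ex : exists n, minimal_base_size n.
Proof.
case: (ex_minnP base_exists) => m /asboolP[s bs] minm.
exists m; apply/asboolP; exists s; split=> // i fixi.
case: m s bs minm i fixi => [|m] s bs minm i fixi; first by case: i {fixi}.
suff: m < m by rewrite ltnn.
apply: minm; apply/asboolP; exists [tuple tnth s (lift i k) | k < m].
rewrite /is_base -bs; apply/setP=> g; rewrite !inE.
apply: andb_id2l => Gg; apply/asboolP/asboolP => fixg; last first.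
  by move=> k _; rewrite tnth_mktuple; apply: fixg; rewrite inE.
have fixl k : k != i -> to (tnth s k) g = tnth s k.
  case: (unliftP i k) => [j ->|->]; last by rewrite eqxx.
  by move=> _; have := fixg j (in_setT _); rewrite tnth_mktuple.
move=> j _; have [->|/fixl//] := eqVneq j i.
apply: fixi; rewrite inE Gg; apply/asboolP => k.
by rewrite !inE; apply: fixl.
Qed.

Lemma minimal_base_size_bound n : minimal_base_size n -> n <= #|gT|.
Proof.
move=> /asboolP[s [_ mins]].
have wit (i : 'I_n) : exists g, g \in pt_stab s [set~ i] /\
    to (tnth s i) g <> tnth s i.
  apply: contrapT => nog; apply: (mins i) => g gstab.
  by apply: contrapT => nfix; apply: nog; exists g.
have /choice[f fP] := wit.
have injf : injective f.
  move=> i j eqf; apply/eqP; apply: contrapT => /negP neq.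
  have [_ nfix] := fP i; have [] := fP j; rewrite -eqf inE => /andP[_].
  by move=> /asboolP fixf _; apply: nfix; apply: fixf; rewrite !inE.
by have := leq_card f injf; rewrite card_ord.
Qed.

Definition max_minimal_base_size : nat :=
  ex_maxn minimal_base_size_ex minimal_base_size_bound.

End Bases.

Section Invariants.

Variable gT : finGroupType.

Definition rep_base_number (G : {group gT}) (n : nat) : bool :=
  `[< exists (Omega : Type) (to : action G Omega),
        max_minimal_base_size to = n >].

Lemma rep_base_number_ex (G : {group gT}) : exists n, rep_base_number G n.
Proof.
have acttt : is_action G (fun (x : unit) (_ : gT) => x).
  by split=> [a x y|x a b _ _].
exists (max_minimal_base_size (Action acttt)).
by apply/asboolP; exists unit, (Action acttt).
Qed.

Lemma rep_base_number_bound (G : {group gT}) n :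
  rep_base_number G n -> n <= #|gT|.
Proof.
move=> /asboolP[Omega [to <-]]; rewrite /max_minimal_base_size.
by case: ex_maxnP => m /minimal_base_size_bound.
Qed.

Definition b2 (G : {group gT}) : nat :=
  ex_maxn (rep_base_number_ex G) (@rep_base_number_bound G).

Definition independent (A : {set gT}) : bool :=
  [forall x in A, x \notin <<A :\ x>>].

Definition mu (G : {group gT}) : nat :=
  \max_(A : {set gT} | independent A && (<<A>> == G)) #|A|.

(* The empty case of [\max] does not arise in [mu]. *)
Lemma independent_gen_ex (G : {group gT}) :
  exists A : {set gT}, independent A && (<<A>> == G).
Proof.
have genG : <<G>> == G :> {set gT} by rewrite genGid.
have [A /minsetP[/eqP genA minA] _] :=
  minset_exists (P := fun A : {set gT} => <<A>> == G) genG.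
exists A; rewrite genA eqxx andbT; apply/forall_inP => x Ax.
apply/negP => genx; have /setP/(_ x) : A :\ x = A; last by rewrite !inE eqxx Ax.
apply: minA; last exact: subD1set.
rewrite -genA eqEsubset genS ?subD1set //= gen_subG.
apply/subsetP => y Ay; have [->//|neq] := eqVneq y x.
by apply: mem_gen; rewrite !inE neq.
Qed.

Definition mu' (G : {group gT}) : nat :=
  \max_(H : {group gT} | H \subset G) mu H.

End Invariants.

(* Main.v *)
Require Import Defs.
From mathcomp Require Import all_boot all_fingroup.
From mathcomp Require Import boolp.

(** Let [s] be a minimal base with [n] points. Minimality supplies, for each
    [i], an element [f i] of [G] that fixes every point of [s] except the
    [i]-th, which it moves. The elements [f j] with [j != i] all lie in the
    stabiliser of the [i]-th point, hence so does the subgroup they generate,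
    whereas [f i] does not: the [f i] are therefore [n] distinct elements
    forming an independent set. Independent subsets of [G] have size at most
    [mu' G], since such a set is an independent generating set of the subgroup
    it generates. The two halves are [minimal_base_independent] and
    [independent_leq_mu']. *)

Set Implicit Arguments.
Unset Strict Implicit.
Unset Printing Implicit Defensive.

Import GroupScope.

Lemma independent_leq_mu' (gT : finGroupType) (G : {group gT}) (A : {set gT}) :
  A \subset G -> independent A -> #|A| <= mu' G.
Proof.
move=> sAG indA; apply: (@leq_trans (mu <<A>>%G)).
  rewrite /mu; apply: (@leq_bigmax_cond _ _ (fun B : {set gT} => #|B|)).
  by rewrite indA /=.
rewrite /mu'; apply: (@leq_bigmax_cond _ _ (fun H : {group gT} => mu H)).
by rewrite gen_subG.
Qed.

Section MinimalBases.

Variables (gT : finGroupType) (G : {group gT}) (Omega : Type).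
Variable to : action G Omega.

Lemma pt_stab_group_set n (s : n.-tuple Omega) (I : {set 'I_n}) :
  group_set (pt_stab to s I).
Proof.
have [to_inj toM] : is_action G to by case: to.
apply/group_setP; split=> [|g h].
  (* The identity acts as an injective idempotent, hence trivially. *)
  rewrite inE group1; apply/asboolP => i _; apply: (to_inj 1).
  by rewrite -toM ?mulg1.
rewrite !inE => /andP[Gg /asboolP fixg] /andP[Gh /asboolP fixh].
rewrite groupM //; apply/asboolP => i Ii.
by rewrite toM // fixg ?fixh.
Qed.

Canonical pt_stab_group n (s : n.-tuple Omega) (I : {set 'I_n}) :=
  Group (pt_stab_group_set s I).

Lemma pt_stabS n (s : n.-tuple Omega) (I J : {set 'I_n}) :
  I \subset J -> pt_stab to s J \subset pt_stab to s I.
Proof.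
move=> /subsetP sIJ; apply/subsetP => g; rewrite !inE => /andP[-> /asboolP fixg].
by apply/asboolP => i /sIJ; apply: fixg.
Qed.

(** Membership in the subgroup generated by the other elements is ruled out
    by a stabiliser: [pt_stab to s [set i]] is a group containing every chosen
    element but the [i]-th. *)
Lemma minimal_base_independent n (s : n.-tuple Omega) :
  is_minimal_base to s ->
  exists A : {set gT}, [/\ A \subset G, independent A & #|A| = n].
Proof.
move=> [_ mins].
have wit (i : 'I_n) : exists g,
    g \in pt_stab to s [set~ i] :\: pt_stab to s [set i].
  apply: contrapT => nog; apply: (mins i) => g gstab.
  apply: contrapT => nfix; apply: nog; exists g; rewrite !in_setD gstab andbT.
  by apply/negP; rewrite inE => /andP[_ /asboolP/(_ i (set11 i))].
have /choice[f fP] := wit.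
have f_stab i : f i \in pt_stab to s [set~ i].
  by have := fP i; rewrite in_setD => /andP[].
have f_move i : f i \notin pt_stab to s [set i].
  by have := fP i; rewrite in_setD => /andP[].
have f_fix i j : j != i -> f j \in pt_stab to s [set i].
  move=> neq; apply: (subsetP (pt_stabS _ _)) (f_stab j).
  by rewrite sub1set !inE eq_sym.
have injf : injective f.
  move=> i j eqf; apply/eqP; apply: contraT => neq.
  by have := f_fix j i neq; rewrite eqf (negPf (f_move j)).
exists [set f i | i : 'I_n]; split; last by rewrite card_imset ?card_ord.
  by apply/subsetP => _ /imsetP[i _ ->]; have := f_stab i; rewrite inE => /andP[].
apply/forall_inP => _ /imsetP[i _ ->]; apply: contra (f_move i).
apply/subsetP; rewrite gen_subG.
apply/subsetP => g /setD1P[neq /imsetP[j _ def_g]].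
by rewrite def_g; apply: f_fix; apply: contraNneq neq => <-; rewrite def_g.
Qed.

End MinimalBases.

Theorem corollary3p3 (gT : finGroupType) (G : {group gT}) :
  (b2 G <= mu' G)%N.
Proof.
rewrite /b2; case: ex_maxnP => _ /asboolP[Omega [to <-]] _.
rewrite /max_minimal_base_size; case: ex_maxnP => n /asboolP[s mins] _.
have [A [sAG indA <-]] := minimal_base_independent mins.
exact: independent_leq_mu'.
Qed.
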